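(* Let $(\mathcal F,\omega)$ be a rank $2k$ symplectic foliation on a manifold $M$ with corresponding regular Poisson structure $\Pi$, and let $G$ be a distribution with $TM=G\oplus T\mathcal F$. The fiber preserving diffeomorphism $$\exp_G:\mathcal I_\gamma\xrightarrow{\ \sim\ }\Pi+\mathcal I_{-\gamma},\qquad Z\mapsto\exp_G(Z):=\Pi+Z^\gamma,$$ induces the following bijection at the level of sections: $$\Gamma(\mathcal I_\gamma)\cap\mathfrak X^2_{\mathcal F}(M)\xrightarrow{\ \sim\ }\{W\in\mathfrak X^2_{\text{reg-}2k}(M) : \operatorname{im}W^\sharp\text{ is transverse to }G\},\qquad Z\mapsto\exp_G(Z).$$
   Context: A rank $2k$ symplectic foliation $(\mathcal F,\omega)$ is a regular foliation with tangent distribution $T\mathcal F$ of rank $2k$ and a leafwise closed non-degenerate $\omega\in\Gamma(\wedge^2T^*\mathcal F)$; $\omega^\flat(X)=\iota_X\omega$. The corresponding regular Poisson structure is $\Pi=-\omega^{-1}\in\Gamma(\wedge^2T\mathcal F)$: $\Pi^\sharp(\eta)=\iota_\eta\Pi$ has image $T\mathcal F$, kernel the annihilator $T^\circ\mathcal F$, and induces $-(\omega^\flat)^{-1}:T^*\mathcal F\to T\mathcal F$. With $T^*\mathcal F\cong G^\circ$, $\gamma\in\Omega^2(M)$ is the unique 2-form with $\gamma^\flat|_{T\mathcal F}=\omega^\flat$ and $\gamma^\flat|_G=0$. For a 2-form $\beta$ on $M$ (here $\beta=\pm\gamma$), $\mathcal I_\beta=\bigsqcup_{x\in M}\{Z_x\in\wedge^2T_xM:\operatorname{id}_{T^*_xM}+\beta_x^\flat\circ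 Z_x^\sharp\text{ is invertible}\}$, an open neighborhood of the zero section of $\wedge^2TM$; $\Gamma(\mathcal I_\beta)$ is the set of bivector fields with values in it. For $Z\in\mathcal I_\gamma$, $Z^\gamma$ is the bivector with $(Z^\gamma)^\sharp=Z^\sharp\circ(\operatorname{id}+\gamma^\flat\circ Z^\sharp)^{-1}$. Good bivector fields: $\mathfrak X^2_{\mathcal F}(M)=\{W\in\mathfrak X^2(M): W(\alpha,\beta)=0\ \forall\alpha,\beta\in\Gamma(T^\circ\mathcal F)\}$. $\mathfrak X^2_{\text{reg-}2k}(M)$ is the space of bivector fields $W$ on $M$ for which $W^\sharp$ has constant rank $2k$ (not necessarily Poisson). Transverse to $G$ means $TM=\operatorname{im}W^\sharp\oplus G$. *)

(* Defs.v *)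
From mathcomp Require Import all_boot all_order all_algebra.
From mathcomp Require Import all_classical all_reals all_analysis.
Import Order.TTheory GRing.Theory Num.Theory numFieldNormedType.Exports.

Set Implicit Arguments.
Unset Strict Implicit.
Unset Printing Implicit Defensive.

Local Open Scope classical_set_scope.
Local Open Scope ring_scope.

(** * Smooth maps between open subsets of finite-dimensional normed spaces *)

(* Used only for U open and V finite-dimensional, where f is C^(k+1) iff it is
   differentiable and all its directional derivatives are C^k. *)
Fixpoint class_C (R : realType) (V W : normedModType R) (k : nat) (U : set V)
    (f : V -> W) {struct k} : Prop :=
  match k with
  | 0%N => forall x, U x -> {for x, continuous f}
  | k'.+1 => (forall x, U x -> differentiable f x) /\
             (forall v : V, class_C k' U (fun x => 'D_v f x))
  end.

Definition smooth_on (R : realType) (V W : normedModType R) (U : set V)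
    (f : V -> W) : Prop :=
  forall k : nat, class_C k U f.

(** * Smooth manifolds *)

(* [to] and [from] are total functions; they are meaningful only on [dom] and
   on the image of [dom] under [to], respectively. *)
Record chart (R : realType) (n : nat) (T : topologicalType) := Chart {
  dom : set T;
  to : T -> 'rV[R]_n;
  from : 'rV[R]_n -> T;
  dom_open : open dom;
  cod_open : open (to @` dom);
  to_fromK : forall x, dom x -> from (to x) = x;
  to_cont : forall x, dom x -> {for x, continuous to};
  from_cont : forall u, (to @` dom) u -> {for u, continuous from}
}.

Definition cod (R : realType) (n : nat) (T : topologicalType)
    (c : chart R n T) : set 'rV[R]_n :=
  to c @` dom c.

Definition smooth_transition (R : realType) (n : nat) (T : topologicalType)
    (c d : chart R n T) : Prop :=
  smooth_on (to c @` (dom c `&` dom d)) (to d \o from c).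

Definition compatible (R : realType) (n : nat) (T : topologicalType)
    (c d : chart R n T) : Prop :=
  smooth_transition c d /\ smooth_transition d c.

Record manifold (R : realType) (n : nat) := Manifold {
  carrier :> topologicalType;
  atlas : set (chart R n carrier);
  chart_at : carrier -> chart R n carrier;
  chart_at_atlas : forall x, atlas (chart_at x);
  chart_at_dom : forall x, dom (chart_at x) x;
  atlas_compatible : forall c d, atlas c -> atlas d -> compatible c d;
  atlas_maximal : forall c, (forall d, atlas d -> compatible c d) -> atlas c;
  manifold_hausdorff : hausdorff_space carrier;
  manifold_second_countable : @second_countable carrier
}.

(** * Tensors *)

(* The tangent space T_xM is R^n ('rV[R]_n), a vector being identified with its
   components in the preferred chart [chart_at M x].  A covector is the row
   vector of its components in the dual basis, paired with vectors by
   [eta *m v^T].  A bivector Z is the skew-symmetric matrix with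
   Z(eta,theta) = eta *m Z *m theta^T, and a 2-form b the skew-symmetric matrix
   with b(v,w) = v *m b *m w^T.  Matrices act on row vectors from the right:
     Z^#(eta) = Z(eta, -) = eta *m Z,      b^flat(v) = b(v, -) = v *m b,
   so that im Z^# is the row space of Z, and the operator
   id + b^flat o Z^# on covectors has matrix 1%:M + Z *m b. *)

Definition skew_mx (R : realType) (n : nat) (A : 'M[R]_n) : Prop := A^T = - A.

(* Matrix of the change of tangent coordinates at y from chart c to chart d. *)
Definition Jac (R : realType) (n : nat) (M : manifold R n)
    (c d : chart R n M) (y : M) : 'M[R]_n :=
  jacobian (to d \o from c) (to c y).

(* Components in the chart c of a covector, a bivector and a 2-form at y. *)
Definition covector_in (R : realType) (n : nat) (M : manifold R n)
    (c : chart R n M) (y : M) (eta : 'rV[R]_n) : 'rV[R]_n :=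
  eta *m (Jac c (chart_at y) y)^T.

Definition bivector_in (R : realType) (n : nat) (M : manifold R n)
    (c : chart R n M) (y : M) (Z : 'M[R]_n) : 'M[R]_n :=
  (Jac (chart_at y) c y)^T *m Z *m Jac (chart_at y) c y.

Definition form2_in (R : realType) (n : nat) (M : manifold R n)
    (c : chart R n M) (y : M) (b : 'M[R]_n) : 'M[R]_n :=
  Jac c (chart_at y) y *m b *m (Jac c (chart_at y) y)^T.

Definition smooth_field (R : realType) (n : nat) (M : manifold R n)
    (V : normedModType R) (comp : chart R n M -> M -> V -> V)
    (s : M -> V) : Prop :=
  forall c, atlas c ->
    smooth_on (cod c) (fun u => comp c (from c u) (s (from c u))).

Definition form1_field (R : realType) (n : nat) (M : manifold R n)
    (a : M -> 'rV[R]_n) : Prop :=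
  smooth_field (@covector_in R n M) a.

Definition bivector_field (R : realType) (n : nat) (M : manifold R n)
    (Z : M -> 'M[R]_n) : Prop :=
  (forall x, skew_mx (Z x)) /\ smooth_field (@bivector_in R n M) Z.

Definition form2_field (R : realType) (n : nat) (M : manifold R n)
    (b : M -> 'M[R]_n) : Prop :=
  (forall x, skew_mx (b x)) /\ smooth_field (@form2_in R n M) b.

(** * Distributions and foliations *)

(* A field of subspaces of the tangent spaces is given by matrices D x, standing
   for their row spaces. *)

Definition direct_sum (R : realType) (n : nat) (A B : 'M[R]_n) : Prop :=
  (A + B :=: 1%:M)%MS /\ (A :&: B = 0)%MS.

(* Smooth subbundle of TM: the rows of B form a local frame, in a chart c. *)
Definition smooth_distribution (R : realType) (n : nat) (M : manifold R n)
    (D : M -> 'M[R]_n) : Prop :=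
  forall p : M, exists c : chart R n M, exists U : set M,
  exists r : nat, exists B : 'rV[R]_n -> 'M[R]_(r, n),
    [/\ atlas c, open U, U p, U `<=` dom c & smooth_on (to c @` U) B /\
        forall y, U y ->
          row_free (B (to c y)) /\
          (D y *m Jac (chart_at y) c y :=: B (to c y))%MS].

(* c is a foliated chart: D is spanned by the first r coordinate fields. *)
Definition foliated_chart (R : realType) (n : nat) (M : manifold R n) (r : nat)
    (D : M -> 'M[R]_n) (c : chart R n M) : Prop :=
  atlas c /\
  forall y, dom c y ->
    (D y *m Jac (chart_at y) c y :=: (pid_mx r : 'M[R]_n))%MS.

(* D is the tangent distribution of a regular foliation of rank r. *)
Definition foliation (R : realType) (n : nat) (M : manifold R n) (r : nat)
    (D : M -> 'M[R]_n) : Prop :=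
  (forall x, \rank (D x) = r) /\
  (forall p : M, exists2 c, foliated_chart r D c & dom c p).

(* Leafwise 2-forms are elements of /\^2 T^*F: only the values
   v *m omega x *m w^T with v, w tangent to the leaves are meaningful, so that
   omega x may be any matrix extending the form on T_xF.  In a foliated chart
   the components of omega are the entries a, b < r of [form2_in]. *)
Definition leafwise_form2 (R : realType) (n : nat) (M : manifold R n) (r : nat)
    (D omega : M -> 'M[R]_n) : Prop :=
  (forall (x : M) (v w : 'rV[R]_n), (v <= D x)%MS -> (w <= D x)%MS ->
     v *m omega x *m w^T = - (w *m omega x *m v^T)) /\
  (forall c, foliated_chart r D c -> forall a b : 'I_n, (a < r)%N -> (b < r)%N ->
     smooth_on (cod c)
       (fun u => form2_in c (from c u) (omega (from c u)) a b : R^o)).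

Definition leafwise_closed (R : realType) (n : nat) (M : manifold R n) (r : nat)
    (D omega : M -> 'M[R]_n) : Prop :=
  forall c, foliated_chart r D c ->
  let w a b : 'rV[R]_n -> R^o :=
    fun u => form2_in c (from c u) (omega (from c u)) a b in
  let e a : 'rV[R]_n := delta_mx 0 a in
  forall a1 a2 a3 : 'I_n, (a1 < r)%N -> (a2 < r)%N -> (a3 < r)%N ->
  forall u, cod c u ->
    'D_(e a1) (w a2 a3) u + 'D_(e a2) (w a3 a1) u + 'D_(e a3) (w a1 a2) u = 0.

Definition leafwise_nondegenerate (R : realType) (n : nat) (M : manifold R n)
    (D omega : M -> 'M[R]_n) : Prop :=
  forall (x : M) (v : 'rV[R]_n), (v <= D x)%MS ->
    (forall w : 'rV[R]_n, (w <= D x)%MS -> v *m omega x *m w^T = 0) -> v = 0.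

Definition symplectic_foliation (R : realType) (n : nat) (M : manifold R n)
    (r : nat) (D omega : M -> 'M[R]_n) : Prop :=
  [/\ foliation r D, leafwise_form2 r D omega, leafwise_closed r D omega &
      leafwise_nondegenerate D omega].

Definition annihilates (R : realType) (n : nat) (eta : 'rV[R]_n)
    (A : 'M[R]_n) : Prop :=
  forall v : 'rV[R]_n, (v <= A)%MS -> eta *m v^T = 0.

(* Pi = - omega^-1; the last clause says omega^flat (Pi^# eta) = - eta|_TF. *)
Definition poisson_of (R : realType) (n : nat) (M : manifold R n)
    (D omega Pi : M -> 'M[R]_n) : Prop :=
  [/\ bivector_field Pi,
      forall x, (Pi x :=: D x)%MS,
      forall x (eta : 'rV[R]_n), eta *m Pi x = 0 <-> annihilates eta (D x) &
      forall x (eta w : 'rV[R]_n), (w <= D x)%MS ->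
        (eta *m Pi x) *m omega x *m w^T = - (eta *m w^T)].

(* The extension gamma of omega by zero on G; the values of gamma^flat on TF are
   in the annihilator of G, identified with T^*F by restriction. *)
Definition extension_by (R : realType) (n : nat) (M : manifold R n)
    (D omega G gamma : M -> 'M[R]_n) : Prop :=
  [/\ form2_field gamma,
      forall x (v : 'rV[R]_n), (v <= D x)%MS ->
        annihilates (v *m gamma x) (G x) /\
        (forall w : 'rV[R]_n, (w <= D x)%MS ->
           v *m gamma x *m w^T = v *m omega x *m w^T) &
      forall x (g : 'rV[R]_n), (g <= G x)%MS -> g *m gamma x = 0].

(** * The bundle of bivectors, I_beta and exp_G *)

(* The total space of /\^2 TM is {(x, Z) | skew_mx Z} in M * 'M[R]_n, with charts
   [bcoord c], taking values in the linear subspace 'rV_n x so(n) of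
   'rV_n * 'M_n. *)
Definition bcoord (R : realType) (n : nat) (M : manifold R n)
    (c : chart R n M) (z : M * 'M[R]_n) : 'rV[R]_n * 'M[R]_n :=
  (to c z.1, bivector_in c z.1 z.2).

Definition open_in_bivectors (R : realType) (n : nat) (M : manifold R n)
    (A : set (M * 'M[R]_n)) : Prop :=
  (forall z, A z -> skew_mx z.2) /\
  (forall z, A z -> forall c : chart R n M, atlas c -> dom c z.1 ->
     exists O : set ('rV[R]_n * 'M[R]_n),
       [/\ open O, O (bcoord c z) &
           forall z' : M * 'M[R]_n, skew_mx z'.2 -> dom c z'.1 -> O (bcoord c z') ->
             A z']).

(* In suitable charts around each point and its image, f is the restriction of a
   smooth map g defined on an open set of the ambient space 'rV_n * 'M_n. *)
Definition smooth_bivector_map (R : realType) (n : nat) (M : manifold R n)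
    (A : set (M * 'M[R]_n)) (f : M * 'M[R]_n -> M * 'M[R]_n) : Prop :=
  forall z, A z -> exists c d : chart R n M,
    [/\ atlas c, atlas d, dom c z.1, dom d (f z).1 &
      exists O : set ('rV[R]_n * 'M[R]_n),
      exists g : 'rV[R]_n * 'M[R]_n -> 'rV[R]_n * 'M[R]_n,
        [/\ open O, O (bcoord c z), smooth_on O g &
            forall z', A z' -> dom c z'.1 -> O (bcoord c z') ->
              dom d (f z').1 /\ bcoord d (f z') = g (bcoord c z')]].

Definition fiber_preserving_diffeo (R : realType) (n : nat) (M : manifold R n)
    (A B : set (M * 'M[R]_n)) (f : M * 'M[R]_n -> M * 'M[R]_n) : Prop :=
  [/\ open_in_bivectors A, open_in_bivectors B, set_bij A B f,
      forall z, A z -> (f z).1 = z.1 &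
      smooth_bivector_map A f /\
      exists2 g, (forall z, A z -> g (f z) = z) & smooth_bivector_map B g].

Definition I_beta (R : realType) (n : nat) (M : manifold R n) (b : M -> 'M[R]_n)
    : set (M * 'M[R]_n) :=
  [set z | skew_mx z.2 /\ 1%:M + z.2 *m b z.1 \in unitmx].

(* Z^b, with (Z^b)^# = Z^# o (id + b^flat o Z^#)^-1. *)
Definition gauge (R : realType) (n : nat) (Z b : 'M[R]_n) : 'M[R]_n :=
  invmx (1%:M + Z *m b) *m Z.

Definition exp_G (R : realType) (n : nat) (M : manifold R n)
    (Pi gamma : M -> 'M[R]_n) (z : M * 'M[R]_n) : M * 'M[R]_n :=
  (z.1, Pi z.1 + gauge z.2 (gamma z.1)).

Definition translate (R : realType) (n : nat) (M : manifold R n)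
    (Pi : M -> 'M[R]_n) (A : set (M * 'M[R]_n)) : set (M * 'M[R]_n) :=
  [set (z.1, Pi z.1 + z.2) | z in A].

(** * Spaces of bivector fields *)

Definition sections (R : realType) (n : nat) (M : manifold R n)
    (A : set (M * 'M[R]_n)) : set (M -> 'M[R]_n) :=
  [set Z | bivector_field Z /\ forall x, A (x, Z x)].

Definition good_bivectors (R : realType) (n : nat) (M : manifold R n)
    (D : M -> 'M[R]_n) : set (M -> 'M[R]_n) :=
  [set W | bivector_field W /\
    forall a b : M -> 'rV[R]_n, form1_field a -> form1_field b ->
      (forall x, annihilates (a x) (D x)) ->
      (forall x, annihilates (b x) (D x)) ->
      forall x, a x *m W x *m (b x)^T = 0].

Definition regular_bivectors (R : realType) (n : nat) (M : manifold R n)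
    (r : nat) : set (M -> 'M[R]_n) :=
  [set W | bivector_field W /\ forall x, \rank (W x) = r].

Definition transverse_to (R : realType) (n : nat) (M : manifold R n)
    (G : M -> 'M[R]_n) : set (M -> 'M[R]_n) :=
  [set W | forall x, direct_sum (W x) (G x)].

(* Main.v *)
Require Import Defs.
From HB Require Import structures.
From mathcomp Require Import all_boot all_order all_algebra ring.
From mathcomp Require Import all_classical all_reals all_analysis.
Import Order.TTheory GRing.Theory Num.Theory numFieldNormedType.Exports.
Local Open Scope classical_set_scope.
Local Open Scope ring_scope.

(** Write N = id + gamma^flat o Pi^#, the projection of covectors onto the
    annihilator of TF along the annihilator of G, so that N Pi = 0 and
    gamma N = 0 as matrices.  A bivector field Z is good iff N Z N^T = 0:
    multiplying by N turns an arbitrary 1-form into one annihilating TF, and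
    every covector extends to a global 1-form by means of a bump function.

    For Z in I_gamma one has (1 + Z gamma) exp_G(Z) = Pi + Z N^T.  If Z is good,
    the right-hand side is Pi (1 - X) with X = gamma Z N^T and X^2 = 0; hence
    exp_G(Z) has the rank of Pi, and its image, the image of TF under 1 - X,
    meets G trivially since X gamma = 0.  Conversely, the rows of
    N (Pi + Z N^T) = N Z N^T lie in both G and im exp_G(Z), hence vanish if
    exp_G(Z) is transverse to G.

    The inverse of exp_G is W |-> (W - Pi)^(-gamma).  Both maps are rational in
    the components in any chart, whence their smoothness. *)

Set Implicit Arguments.
Unset Strict Implicit.
Unset Printing Implicit Defensive.

(** * Smooth maps *)

Section Calculus.
Context {R : realType}.
Implicit Types V W : normedModType R.

(** The first-order expansion of [f] at [x] is also one of [g], and uniqueness of the differential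
    identifies its linear part with ['d g x]. *)
Lemma near_eq_differentiable V W (f g : V -> W) x :
  (\near x, f x = g x) -> differentiable f x -> differentiable g x.
Proof.
move=> fg df.
have fgx : f x = g x by exact: nbhs_singleton fg.
have dg : g \o shift x = cst (g x) + 'd f x +o_ 0 id.
  apply/eqaddoP => e e0; have /eqaddoP/(_ e e0) := diff_locally df.
  have /= := near_shift 0 x (fun z => f z = g z); rewrite subr0 => fg0.
  move: fg; rewrite fg0 => fg.
  apply: filterS2 fg => y fgy.
  by move: fgy; rewrite !fctE /= ?addr0 fgx => ->.
have dc := diff_continuous df.
by apply/diff_locallyP; rewrite (diff_unique dc dg).
Qed.

Lemma derive_comp V V' W (f : V -> V') (g : V' -> W) x v :
  differentiable f x -> differentiable g (f x) ->
  'D_v (g \o f) x = 'D_('D_v f x) g (f x).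
Proof.
move=> df dg; rewrite !deriveE//; last exact: differentiable_comp.
by rewrite diff_comp.
Qed.

Lemma class_C_near_eq V W k (U : set V) (f g : V -> W) :
  (forall x, U x -> \near x, f x = g x) -> class_C k U f -> class_C k U g.
Proof.
elim: k f g => [|k IHk] f g fg /=.
  move=> cf x Ux; have fgx := fg x Ux.
  rewrite /prop_for /continuous_at -(nbhs_singleton fgx).
  exact: cvg_trans (near_eq_cvg fgx) (cf x Ux).
move=> [df cdf]; split=> [x Ux|v].
  exact: near_eq_differentiable (fg x Ux) (df x Ux).
(* Every point close to [x] has a neighbourhood on which [f] and [g] agree, so the directional
   derivatives agree near [x] as well. *)
apply: IHk (cdf v) => x /fg/nbhs_interior; apply: filterS => y.
exact: near_eq_derive.
Qed.

Lemma class_C_eq V W k (U : set V) (f g : V -> W) : open U ->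
  {in U, f =1 g} -> class_C k U f -> class_C k U g.
Proof.
move=> oU fg; apply: class_C_near_eq => x Ux.
by apply: filterS (open_nbhs_nbhs (conj oU Ux)) => y Uy; exact/fg/mem_set.
Qed.

(** [class_C] is a conjunction of conditions at the single points of the set, so it passes to
    arbitrary unions. *)
Lemma class_C_bigcup V W k I (U : I -> set V) (f : V -> W) :
  (forall i, class_C k (U i) f) -> class_C k (\bigcup_i U i) f.
Proof.
elim: k f => [|k IHk] f /= cf; first by move=> x [i _]; exact: cf.
split=> [x [i _]|v]; first exact: (cf i).1.
by apply: IHk => i; exact: (cf i).2.
Qed.

Lemma class_C_sub V W k (U U' : set V) (f : V -> W) :
  U' `<=` U -> class_C k U f -> class_C k U' f.
Proof.
move=> U'U; elim: k f => [|k IHk] f /=; first by move=> cf x /U'U; exact: cf.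
by move=> [df cdf]; split=> [x /U'U|v]; [exact: df|exact/IHk/cdf].
Qed.

Lemma class_CS V W k (U : set V) (f : V -> W) :
  class_C k.+1 U f -> class_C k U f.
Proof.
elim: k f => [|k IHk] f [df cdf]; first by move=> x /df/differentiable_continuous.
by split=> // v; apply: IHk; exact: cdf.
Qed.

Lemma class_C_cst V W k (U : set V) (w : W) : class_C k U (cst w).
Proof.
elim: k w => [|k IHk] w /=; first by move=> x _; exact: cvg_cst.
split=> [x _|v]; first exact: differentiable_cst.
rewrite (_ : (fun x => _) = cst 0)//; apply/funext => x; exact: derive_cst.
Qed.

Lemma class_CD V W k (U : set V) (f g : V -> W) : open U ->
  class_C k U f -> class_C k U g -> class_C k U (fun x => f x + g x).
Proof.
move=> oU; elim: k f g => [|k IHk] f g /=.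
  by move=> cf cg x Ux; apply: cvgD; [exact: cf|exact: cg].
move=> [df cdf] [dg cdg]; split=> [x Ux|v].
  by apply: differentiableD; [exact: df|exact: dg].
apply: class_C_eq (IHk _ _ (cdf v) (cdg v)) => // x /set_mem Ux.
by rewrite deriveD//; apply: diff_derivable; [exact: df|exact: dg].
Qed.

Lemma class_C_linear V W W' k (U : set V) (L : {linear W -> W'}) (f : V -> W) :
  open U -> continuous L -> class_C k U f -> class_C k U (fun x => L (f x)).
Proof.
move=> oU cL; elim: k f => [|k IHk] f /=.
  by move=> cf x Ux; apply: continuous_comp; [exact: cf|exact: cL].
move=> [df cdf].
have dLf x : U x -> differentiable (fun x => L (f x)) x.
  move=> Ux; apply: (@differentiable_comp _ _ _ _ f L); first exact: df.
  exact: linear_differentiable.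
split=> // v; apply: class_C_eq (IHk _ (cdf v)) => // x /set_mem Ux.
have dL := @linear_differentiable _ _ _ L (f x) cL.
by rewrite [RHS](derive_comp _ (df x Ux) dL) (deriveE _ dL) diff_lin.
Qed.

(** The derivative of [f \o L] along [v] is ['D_(L v) f \o L], again a composite with [L], so the
    induction closes. *)
Lemma class_C_comp_linear V V' W k (U : set V) (L : {linear V' -> V})
    (f : V -> W) : open U -> continuous L ->
  class_C k U f -> class_C k (L @^-1` U) (fun x => f (L x)).
Proof.
move=> oU cL; elim: k f => [|k IHk] f /=.
  by move=> cf x Ux; apply: continuous_comp; [exact: cL|exact: cf].
move=> [df cdf].
have dfL x : U (L x) -> differentiable (fun x => f (L x)) x.
  move=> Ux; apply: (@differentiable_comp _ _ _ _ L f); last exact: df.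
  exact: linear_differentiable.
split=> // v; have oLU : open (L @^-1` U) by exact: open_comp.
apply: class_C_eq (IHk _ (cdf (L v))) => // x /set_mem Ux.
have dL := @linear_differentiable _ _ _ L x cL.
by rewrite [RHS](derive_comp _ dL (df _ Ux)) (deriveE _ dL) diff_lin.
Qed.

Lemma class_CM V k (U : set V) (f g : V -> R^o) : open U ->
  class_C k U f -> class_C k U g -> class_C k U (fun x => f x * g x : R^o).
Proof.
move=> oU; elim: k f g => [|k IHk] f g.
  by move=> cf cg x Ux; apply: cvgM; [exact: cf|exact: cg].
move=> Cf Cg; have [df cdf] := Cf; have [dg cdg] := Cg; split=> [x Ux|v].
  by apply: differentiableM; [exact: df|exact: dg].
(* The Leibniz rule multiplies each function by a derivative of the other; [class_CS] brings the
   underived one down to order [k]. *)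
apply: class_C_eq (class_CD oU (IHk _ _ (class_CS Cf) (cdg v))
  (IHk _ _ (class_CS Cg) (cdf v))) => // x /set_mem Ux.
by rewrite deriveM//; apply: diff_derivable; [exact: df|exact: dg].
Qed.

Lemma class_CV V k (U : set V) (f : V -> R^o) : open U ->
  (forall x, U x -> f x != 0) -> class_C k U f ->
  class_C k U (fun x => (f x)^-1 : R^o).
Proof.
move=> oU f0; elim: k => [|k IHk].
  by move=> cf x Ux; apply: cvgV; [exact: f0|exact: cf].
move=> Cf; have [df cdf] := Cf; split=> [x Ux|v].
  by apply: differentiableV; [exact: df|exact: f0].
have CV := IHk (class_CS Cf).
have CN := class_C_cst k U (-1 : R^o).
have CVV := class_CM oU CN (class_CM oU CV CV).
apply: class_C_eq (class_CM oU CVV (cdf v)) => //.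
move=> x /set_mem Ux; rewrite deriveV//; [|exact: f0|exact/diff_derivable/df].
by rewrite -[LHS]/(-1 * _ * _) mulN1r -invfM.
Qed.

Lemma smooth_on_eq V W (U : set V) (f g : V -> W) : open U ->
  {in U, f =1 g} -> smooth_on U f -> smooth_on U g.
Proof. by move=> oU fg sf k; exact: class_C_eq (sf k). Qed.

Lemma smooth_on_ext V W (U : set V) (f g : V -> W) :
  g =1 f -> smooth_on U f -> smooth_on U g.
Proof. by move=> /funext ->. Qed.

Lemma smooth_on_sub V W (U U' : set V) (f : V -> W) :
  U' `<=` U -> smooth_on U f -> smooth_on U' f.
Proof. by move=> U'U sf k; exact: class_C_sub (sf k). Qed.

Lemma smooth_on_local V W (U : set V) (f : V -> W) :
  (forall x, U x -> exists2 U', U' x & smooth_on U' f) -> smooth_on U f.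
Proof.
(* Indexing the union by all sets on which [f] is of class [k] avoids choosing a set [U'] for each
   point. *)
move=> Uf k; pose I := {U' : set V | class_C k U' f}.
apply: (@class_C_sub _ _ _ (\bigcup_(i : I) sval i)); last first.
  by apply: class_C_bigcup => -[].
by move=> x /Uf [U' U'x sf]; exists (exist _ U' (sf k)).
Qed.

Lemma smooth_on_continuous V W (U : set V) (f : V -> W) x :
  smooth_on U f -> U x -> {for x, continuous f}.
Proof. by move=> /(_ 0%N); exact. Qed.

Lemma smooth_on_differentiable V W (U : set V) (f : V -> W) x :
  smooth_on U f -> U x -> differentiable f x.
Proof. by move=> /(_ 1%N) [df _]; exact: df. Qed.

Lemma smooth_on_derive V W (U : set V) (f : V -> W) v :
  smooth_on U f -> smooth_on U ('D_v f).
Proof. by move=> sf k; have [_] := sf k.+1; exact. Qed.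

Lemma smooth_on_cst V W (U : set V) (w : W) : smooth_on U (fun=> w).
Proof. by move=> k; exact: class_C_cst. Qed.

Section Open.
Context {V : normedModType R} {U : set V} (oU : open U).

Lemma smooth_onD W (f g : V -> W) :
  smooth_on U f -> smooth_on U g -> smooth_on U (fun x => f x + g x).
Proof. by move=> sf sg k; exact: class_CD. Qed.

Lemma smooth_on_sum W I (r : seq I) (P : pred I) (f : I -> V -> W) :
  (forall i, smooth_on U (f i)) ->
  smooth_on U (fun x => \sum_(i <- r | P i) f i x).
Proof.
move=> sf; apply: smooth_on_ext => [x|]; first by rewrite -big_filter.
elim: [seq _ <- _ | _] => [|i s IHs].
  apply: smooth_on_ext => [x|]; first by rewrite big_nil.
  exact: smooth_on_cst.
apply: smooth_on_ext => [x|]; first by rewrite big_cons.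
exact: smooth_onD.
Qed.

Lemma smooth_on_linear W W' (L : {linear W -> W'}) (f : V -> W) :
  continuous L -> smooth_on U f -> smooth_on U (fun x => L (f x)).
Proof. by move=> cL sf k; exact: class_C_linear. Qed.

Lemma smooth_onM (f g : V -> R^o) :
  smooth_on U f -> smooth_on U g -> smooth_on U (fun x => f x * g x : R^o).
Proof. by move=> sf sg k; exact: class_CM. Qed.

Lemma smooth_onV (f : V -> R^o) : (forall x, U x -> f x != 0) ->
  smooth_on U f -> smooth_on U (fun x => (f x)^-1 : R^o).
Proof. by move=> f0 sf k; exact: class_CV. Qed.

Lemma smooth_on_prod I (r : seq I) (P : pred I) (f : I -> V -> R^o) :
  (forall i, smooth_on U (f i)) ->
  smooth_on U (fun x => \prod_(i <- r | P i) f i x : R^o).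
Proof.
move=> sf; apply: smooth_on_ext => [x|]; first by rewrite -big_filter.
elim: [seq _ <- _ | _] => [|i s IHs].
  apply: smooth_on_ext => [x|]; first by rewrite big_nil.
  exact: smooth_on_cst.
apply: smooth_on_ext => [x|]; first by rewrite big_cons.
exact: smooth_onM.
Qed.

Lemma smooth_onZl W (f : V -> R^o) (w : W) :
  smooth_on U f -> smooth_on U (fun x => f x *: w).
Proof.
have @L : {linear R^o -> W}.
  exists ( *:%R^~ w); do 2![eexists]; do ?[constructor].
  - by rewrite scale0r.
  - by move=> a b; rewrite scalerDl.
  - by move=> a b; rewrite scalerA.
by move=> sf; apply: (smooth_on_linear (L := L)) => //; exact: scalel_continuous.
Qed.

Lemma smooth_on_coord m n (A : V -> 'M[R]_(m, n)) i j :
  smooth_on U A -> smooth_on U (fun x => A x i j : R^o).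
Proof.
have @L : {linear 'M[R]_(m, n) -> R^o}.
  by exists (fun N : 'M[R]_(_, _) => N i j); do 2![eexists]; do ?[constructor];
     rewrite ?mxE// => ? *; rewrite ?mxE//; move=> ?; rewrite !mxE.
by move=> sA; apply: (smooth_on_linear (L := L)) => //; exact: coord_continuous.
Qed.

Lemma smooth_on_mx m n (A : V -> 'M[R]_(m, n)) :
  (forall i j, smooth_on U (fun x => A x i j : R^o)) -> smooth_on U A.
Proof.
move=> sA; apply: smooth_on_ext => [x|]; first exact: (matrix_sum_delta (A x)).
by apply: smooth_on_sum => i; apply: smooth_on_sum => j; exact: smooth_onZl.
Qed.

Lemma smooth_on_mulmx m n p (A : V -> 'M[R]_(m, n)) (B : V -> 'M[R]_(n, p)) :
  smooth_on U A -> smooth_on U B -> smooth_on U (fun x => A x *m B x).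
Proof.
move=> sA sB; apply: smooth_on_mx => i j.
apply: smooth_on_ext => [x|]; first exact: mxE.
by apply: smooth_on_sum => l; apply: smooth_onM; exact: smooth_on_coord.
Qed.

Lemma smooth_on_trmx m n (A : V -> 'M[R]_(m, n)) :
  smooth_on U A -> smooth_on U (fun x => (A x)^T).
Proof.
move=> sA; apply: smooth_on_mx => i j.
apply: smooth_on_ext => [x|]; first exact: mxE.
exact: smooth_on_coord.
Qed.

Lemma smooth_on_scaler W (a : R) (f : V -> W) :
  smooth_on U f -> smooth_on U (fun x => a *: f x).
Proof.
move=> sf; apply: (smooth_on_linear (L := GRing.scale a)) => //.
exact: scaler_continuous.
Qed.

Lemma smooth_onN W (f : V -> W) : smooth_on U f -> smooth_on U (fun x => - f x).
Proof.
move=> sf; apply: (smooth_on_ext (f := fun x => -1 *: f x)) => [x|].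
  by rewrite scaleN1r.
exact: smooth_on_scaler.
Qed.

Lemma smooth_onB W (f g : V -> W) :
  smooth_on U f -> smooth_on U g -> smooth_on U (fun x => f x - g x).
Proof. by move=> sf sg; apply: smooth_onD => //; exact: smooth_onN. Qed.

Lemma smooth_on_det n (A : V -> 'M[R]_n) :
  (forall i j, smooth_on U (fun x => A x i j : R^o)) ->
  smooth_on U (fun x => \det (A x) : R^o).
Proof.
move=> sA; apply: smooth_on_sum => s; apply: smooth_onM.
  exact: smooth_on_cst.
by apply: smooth_on_prod => i; exact: sA.
Qed.

(** Cramer's rule: the entries are polynomials in those of [A x] divided by the determinant. [invmx]
    has this form on invertible matrices only, so the two functions are compared on [U]. *)
Lemma smooth_on_invmx n (A : V -> 'M[R]_n) :
  (forall x, U x -> A x \in unitmx) ->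
  smooth_on U A -> smooth_on U (fun x => invmx (A x)).
Proof.
move=> uA sA; apply: smooth_on_mx => i j.
have sAij a b : smooth_on U (fun x => A x a b : R^o) by exact: smooth_on_coord.
pose g x : R^o := (\det (A x))^-1 * \adj (A x) i j.
apply: (@smooth_on_eq _ _ _ g) => // [x /set_mem Ux|].
  by rewrite /invmx uA// [in RHS]mxE.
apply: smooth_onM.
  apply: smooth_onV => [x /uA|]; last exact: smooth_on_det.
  by rewrite unitmxE unitfE.
rewrite /adjugate /cofactor; apply: smooth_on_ext => [x|]; first exact: mxE.
apply: smooth_onM; first exact: smooth_on_cst.
apply: smooth_on_det => a b; apply: smooth_on_ext => [x|]; first by rewrite !mxE.
exact: sAij.
Qed.

Lemma smooth_on_pair W W' (f : V -> W) (g : V -> W') :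
  smooth_on U f -> smooth_on U g -> smooth_on U (fun x => (f x, g x)).
Proof.
pose i1 w : W * W' := (w, 0); pose i2 w : W * W' := (0, w).
have lin1 : linear i1.
  by move=> a u v; congr pair => /=; rewrite scaler0 addr0.
have lin2 : linear i2.
  by move=> a u v; congr pair => /=; rewrite scaler0 addr0.
pose L1 : {linear W -> (W * W')%type} :=
  HB.pack i1 (GRing.isLinear.Build _ _ _ _ _ lin1).
pose L2 : {linear W' -> (W * W')%type} :=
  HB.pack i2 (GRing.isLinear.Build _ _ _ _ _ lin2).
move=> sf sg; apply: (@smooth_on_eq _ _ _ (fun x => L1 (f x) + L2 (g x))) => //.
  by move=> x _; congr pair; rewrite ?addr0 ?add0r.
apply: smooth_onD; apply: smooth_on_linear => // w; apply: cvg_pair => //=;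
  by [exact: cvg_id|exact: cvg_cst].
Qed.

Lemma smooth_on_fst W {W'} (f : V -> W) :
  smooth_on U f -> smooth_on [set z : (V * W')%type | U z.1] (fun z => f z.1).
Proof.
pose L : {linear (V * W')%type -> V} := fst.
move=> sf k; apply: (@class_C_comp_linear _ _ _ _ _ L) => //.
by move=> z; exact: cvg_fst.
Qed.

End Open.

Lemma smooth_on_id V (U : set V) : smooth_on U id.
Proof.
case=> [|k]; first by move=> x _; exact: cvg_id.
split=> [x _|v]; first exact: ex_diff.
rewrite (_ : (fun x => _) = cst v); first exact: class_C_cst.
by apply/funext => x; exact: derive_id.
Qed.

Lemma smooth_on_snd V W (U : set (V * W)) : open U -> smooth_on U snd.
Proof.
pose L : {linear (V * W)%type -> W} := snd.
move=> oU; apply: (@smooth_on_linear _ _ oU _ _ L); last exact: smooth_on_id.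
by move=> z; exact: cvg_snd.
Qed.

End Calculus.

(** * A flat function *)

Section Flat.
Context {R : realType}.
Implicit Types (p : {poly R}) (t : R).

(** The polynomial factor in [t^-1] makes the family stable under differentiation; [p = 1] gives the
    usual function that is flat at the origin. *)
Definition flat p t : R :=
  if 0 < t then p.[t^-1] * expR (- t^-1) else 0.

(** The exponential series gives [s ^+ i.+2 <= (i.+2)! * expR s] for each monomial. The two extra
    powers yield the quadratic bound at the origin in [flat_le]. *)
Lemma horner_expRN_le p : exists2 C, 0 <= C &
  forall s, 0 < s -> `|p.[s]| * expR (- s) <= C / s ^+ 2.
Proof.
exists (\sum_(i < size p) `|p`_i| * (i.+2)`!%:R).
  by apply: sumr_ge0 => i _; rewrite mulr_ge0.
move=> s s0; rewrite horner_coef.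
apply: le_trans (ler_wpM2r (expR_ge0 _) (ler_norm_sum _ _ _)) _.
rewrite !mulr_suml; apply: ler_sum => i _.
rewrite normrM normrX (gtr0_norm s0) -!mulrA ler_wpM2l//.
rewrite ler_pdivlMr ?exprn_gt0// mulrAC -exprD addn2 expRN.
rewrite ler_pdivrMr ?expR_gt0// mulrC -ler_pdivrMr ?ltr0n ?fact_gt0//.
by apply: le_trans (expR_ge1Dxn i.+1 (ltW s0)); rewrite lerDr.
Qed.

Lemma flat_le p : exists2 C, 0 <= C & forall t, `|flat p t| <= C * t ^+ 2.
Proof.
have [C C0 pC] := horner_expRN_le p; exists C => // t.
rewrite /flat; case: ltP => [t0|_]; last by rewrite normr0 mulr_ge0 ?sqr_ge0.
rewrite normrM (gtr0_norm (expR_gt0 _)) (le_trans (pC _ _)) ?invr_gt0//.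
by rewrite exprVn invrK.
Qed.

Lemma is_derive_flat p t :
  is_derive t 1 (flat p) (flat ('X^2 * (p - p^`())) t).
Proof.
case: (ltgtP t 0) => [t0|t0|->].
- rewrite {2}/flat ltNge (ltW t0)/=; apply: (@near_eq_is_derive _ _ _ (cst 0)).
  near=> u; rewrite /flat ltNge (_ : u <= 0)//.
  by apply/ltW; near: u; exact: lt_nbhsl.
- rewrite {2}/flat t0.
  pose g := (horner p \o GRing.inv) * (expR \o - (GRing.inv : R -> R)).
  apply: (@near_eq_is_derive _ _ _ g).
    by near=> u; rewrite /flat ifT//; near: u; exact: lt_nbhsr.
  have t_neq0 : t != 0 by rewrite gt_eqF.
  have dinv : is_derive t (1 : R) (GRing.inv : R -> R) (- t ^- 2).
    have := @is_deriveV _ id t (1 : R) 1 t_neq0 (is_derive_id _ _).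
    by rewrite -[- _ *: _]/(_ * _) mulr1.
  have d1 := is_derive1_comp (is_derive_poly p t^-1) dinv.
  have d2 := is_derive1_comp (is_derive_expR ((- GRing.inv : R -> R) t))
    (is_deriveN dinv).
  apply: is_derive_eq (is_deriveM d1 d2) _; rewrite /= !hornerE exprVn.
  rewrite -[LHS]/(_ * _ + _ * _); ring.
(* At the origin, [flat_le] bounds the difference quotient by [C] times the absolute value of
   [h]. *)
- rewrite {2}/flat ltxx; have [C C0 fC] := flat_le p.
  have f0 : flat p 0 = 0 by rewrite /flat ltxx.
  suff cv : h^-1 *: (flat p (h *: 1 + 0) - flat p 0) @[h --> 0^'] --> (0 : R).
    by split; [apply/cvg_ex; exists 0|exact/cvg_lim].
  apply/cvgr0Pnorm_le => e e0; near=> h.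
  rewrite f0 subr0 addr0 -[h *: 1]/(h * 1) mulr1 normrM normfV.
  have h0 : 0 < `|h| by rewrite normr_gt0; near: h; exact: nbhs_dnbhs_neq.
  rewrite ler_pdivrMl// (le_trans (fC h))// -real_normK ?num_real// expr2.
  rewrite mulrA mulrC ler_pM2l//.
  (* The denominator is [C + 1] because [C] may be zero. *)
  have : `|h| <= e / (C + 1).
    near: h; apply: dnbhs0_le; rewrite divr_gt0// ltr_wpDl//.
  rewrite ler_pdivlMr ?ltr_wpDl// mulrC; apply: le_trans.
  by rewrite ler_wpM2r// lerDl.
Unshelve. all: by end_near. Qed.

Lemma smooth_flat (V : normedModType R) (U : set V) p (f : V -> R^o) : open U ->
  smooth_on U f -> smooth_on U (fun x => flat p (f x) : R^o).
Proof.
move=> oU sf k; elim: k p => [|k IHk] p.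
  move=> x Ux; apply: continuous_comp; first exact: (sf 0%N).
  apply: differentiable_continuous; apply/derivable1_diffP.
  exact: (@ex_derive _ _ _ _ _ _ _ (is_derive_flat p (f x))).
have dp t : differentiable (flat p) t.
  apply/derivable1_diffP.
  exact: (@ex_derive _ _ _ _ _ _ _ (is_derive_flat p t)).
have [df cdf] := sf k.+1; split=> [x Ux|v].
  by apply: (@differentiable_comp _ _ _ _ f (flat p)); [exact: df|exact: dp].
apply: class_C_eq (class_CM oU (cdf v) (IHk ('X^2 * (p - p^`())))) => //.
move=> x /set_mem Ux; rewrite [RHS](derive_comp _ (df x Ux) (dp (f x))).
rewrite [RHS]deriveE// diff1E// derive1E.
by rewrite (@derive_val _ _ _ _ _ _ _ (is_derive_flat p (f x))).
Qed.

End Flat.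

(** * Linear algebra of the exponential *)

Section Gauge.
Context {R : realType} {n : nat}.
Implicit Types A B Z b J : 'M[R]_n.

(** With [U = 1%:M + Z *m b], the left-hand side is [1%:M - invmx U *m (U - 1%:M)]. This is why the
    gauge by [- b] undoes the gauge by [b]. *)
Lemma gauge_unit Z b : 1%:M + Z *m b \in unitmx ->
  1%:M + gauge Z b *m - b = invmx (1%:M + Z *m b).
Proof.
move=> uZ; rewrite /gauge mulmxN -mulmxA; set U := 1%:M + _ in uZ *.
have -> : Z *m b = U - 1%:M by rewrite /U addrAC subrr add0r.
by rewrite mulmxBr mulmx1 mulVmx// opprB addrC subrK.
Qed.

Lemma gaugeK Z b : 1%:M + Z *m b \in unitmx -> gauge (gauge Z b) (- b) = Z.
Proof.
by move=> uZ; rewrite {1}/gauge gauge_unit// invmxK /gauge mulKVmx.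
Qed.

Lemma unitmx_gauge Z b : 1%:M + Z *m b \in unitmx ->
  1%:M + gauge Z b *m - b \in unitmx.
Proof. by move=> uZ; rewrite gauge_unit// unitmx_inv. Qed.

Lemma skew_gauge Z b : skew_mx Z -> skew_mx b ->
  1%:M + Z *m b \in unitmx -> skew_mx (gauge Z b).
Proof.
rewrite /skew_mx => sZ sb uZ.
have ubZ : 1%:M + b *m Z \in unitmx.
  rewrite -unitmx_tr linearD /= trmx1 trmx_mul sZ sb.
  by rewrite mulNmx mulmxN opprK.
(* Transposition puts the inverse factor on the other side of [Z]; this identity moves it back. *)
have e : Z *m (1%:M + b *m Z) = (1%:M + Z *m b) *m Z.
  by rewrite mulmxDr mulmxDl mulmx1 mul1mx mulmxA.
rewrite /gauge trmx_mul trmx_inv linearD /= trmx1 trmx_mul sZ sb.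
rewrite [- b *m _]mulNmx mulmxN opprK mulNmx; congr (- _).
by apply: (canRL (mulKmx uZ)); rewrite mulmxA -e mulmxK.
Qed.

Lemma conj_unitmx J A J' :
  J *m J' = 1%:M -> J' *m A *m J \in unitmx = (A \in unitmx).
Proof.
by move=> JJ'; have [uJ uJ'] := mulmx1_unit JJ'; rewrite !unitmx_mul uJ uJ' andbT.
Qed.

(** [J] is the Jacobian of a coordinate change and [J'] its inverse: the operator [1%:M + Z *m b] on
    covectors is conjugated, so invertibility and [gauge] do not depend on the chart. *)
Lemma gauge_conjE J J' Z b : J *m J' = 1%:M ->
  1%:M + (J^T *m Z *m J) *m (J' *m b *m J'^T) =
  J^T *m (1%:M + Z *m b) *m J'^T.
Proof.
move=> JJ'; have J'J : J^T *m J'^T = 1%:M.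
  by rewrite -trmx_mul (mulmx1C JJ') trmx1.
rewrite mulmxDr mulmx1 mulmxDl J'J; congr (_ + _).
by rewrite !mulmxA; congr (_ *m _ *m _); rewrite -!mulmxA JJ' mulmx1.
Qed.

Lemma unitmx_gauge_conj J J' Z b : J *m J' = 1%:M ->
  (1%:M + (J^T *m Z *m J) *m (J' *m b *m J'^T) \in unitmx) =
  (1%:M + Z *m b \in unitmx).
Proof.
move=> JJ'; rewrite (gauge_conjE _ _ JJ') conj_unitmx//.
by rewrite -trmx_mul JJ' trmx1.
Qed.

Lemma gauge_conj J J' Z b : J *m J' = 1%:M -> 1%:M + Z *m b \in unitmx ->
  gauge (J^T *m Z *m J) (J' *m b *m J'^T) = J^T *m gauge Z b *m J.
Proof.
move=> JJ' uZ; rewrite {1}/gauge (gauge_conjE _ _ JJ').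
have u : J^T *m (1%:M + Z *m b) *m J'^T \in unitmx.
  by rewrite conj_unitmx// -trmx_mul JJ' trmx1.
apply: (canLR (mulKmx u)); rewrite /gauge -!mulmxA (mulmxA J'^T).
by rewrite -trmx_mul JJ' trmx1 mul1mx (mulmxA _ (invmx _)) mulmxV// mul1mx.
Qed.

End Gauge.

(** * Bivectors and 2-forms on a split vector space *)

Section Splitting.
Context {R : realType} {n : nat}.
Implicit Types (Pi gam G T Z W : 'M[R]_n) (v eta : 'rV[R]_n).

Lemma direct_sum_decomp G T v : direct_sum G T ->
  exists g t : 'rV[R]_n, [/\ (g <= G)%MS, (t <= T)%MS & v = g + t].
Proof.
move=> [GT _]; have : (v <= G + T)%MS by rewrite GT submx1.
move=> /sub_addsmxP [[a c] /= ->]; exists (a *m G), (c *m T).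
by rewrite !submxMl.
Qed.

Lemma direct_sum_rank G T : direct_sum G T -> (\rank G + \rank T)%N = n.
Proof.
by move=> [GT GT0]; rewrite -mxrank_sum_cap GT0 mxrank0 addn0 GT mxrank1.
Qed.

Lemma direct_sumP W G : (\rank W + \rank G)%N = n ->
  (forall v, (v <= W)%MS -> (v <= G)%MS -> v = 0) -> direct_sum W G.
Proof.
move=> rWG WG; have WG0 : (W :&: G = 0)%MS.
  apply/eqP/rowV0P => v; rewrite sub_capmx => /andP[]; exact: WG.
split=> //; apply/eqmxP; rewrite submx1 sub1mx; apply/eqP.
by rewrite -[RHS]rWG -mxrank_sum_cap WG0 mxrank0 addn0.
Qed.

(* [gam] vanishes exactly on [G] and inverts [- Pi] on [im Pi], so that
   [1%:M + Pi *m gam] is the projection of covectors onto the annihilator of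
   [im Pi] along the annihilator of [G]. *)
Definition inverse_along Pi G gam : Prop :=
  [/\ direct_sum G Pi, skew_mx Pi, skew_mx gam,
      (1%:M + Pi *m gam) *m Pi = 0 &
      forall v, (v <= G)%MS -> v *m gam = 0].

Variables Pi gam G : 'M[R]_n.
Hypothesis PG : inverse_along Pi G gam.
Let N := 1%:M + Pi *m gam.

Let GPi : direct_sum G Pi. Proof. by case: PG. Qed.
Let sPi : Pi^T = - Pi. Proof. by case: PG. Qed.
Let sgam : gam^T = - gam. Proof. by case: PG. Qed.
Let NPi : N *m Pi = 0. Proof. by case: PG. Qed.
Let Ggam v : (v <= G)%MS -> v *m gam = 0.
Proof. by case: PG => _ _ _ _; exact. Qed.

Lemma trmx_annproj : N^T = 1%:M + gam *m Pi.
Proof. by rewrite linearD /= trmx1 trmx_mul sPi sgam mulNmx mulmxN opprK. Qed.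

Let PigamPi : Pi *m gam *m Pi = - Pi.
Proof. by have := NPi; rewrite mulmxDl mul1mx => /addr0_eq. Qed.

(** Only the component of a vector along [im Pi] survives [gam], and on it [Pi *m gam *m N] vanishes
    by [PigamPi]. *)
Let gamN : gam *m N = 0.
Proof.
apply/row_matrixP => i; rewrite row_mul row0 -(mul1mx gam) row_mul.
have [g [t [gG /submxP[c ->] ->]]] := direct_sum_decomp (row i 1%:M) GPi.
rewrite mulmxDl (Ggam gG) add0r -!mulmxA (_ : Pi *m _ = 0) ?mulmx0//.
by rewrite /N !mulmxDr mulmx1 !mulmxA PigamPi mulNmx subrr.
Qed.

Let NTgam : N^T *m gam = 0.
Proof.
by apply: trmx_inj; rewrite trmx_mul trmxK sgam mulNmx gamN oppr0 trmx0.
Qed.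

(** The component [c *m Pi] of [v] satisfies [c *m Pi *m gam = 0]; multiplying by [Pi] turns this
    into [- (c *m Pi) = 0]. *)
Let gam_eq0 v : v *m gam = 0 -> (v <= G)%MS.
Proof.
have [g [t [gG /submxP[c ->] ->]]] := direct_sum_decomp v GPi.
rewrite mulmxDl (Ggam gG) add0r => /(congr1 (mulmx^~ Pi)).
by rewrite -!mulmxA (mulmxA Pi) PigamPi mul0mx mulmxN => /eqP;
  rewrite oppr_eq0 => /eqP ->; rewrite addr0.
Qed.

Lemma annihilates_annproj eta : eta *m N *m Pi = 0.
Proof. by rewrite -mulmxA NPi mulmx0. Qed.

Let expE Z : 1%:M + Z *m gam \in unitmx ->
  (1%:M + Z *m gam) *m (Pi + gauge Z gam) = Pi + Z *m N^T.
Proof.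
move=> uZ; rewrite mulmxDr /gauge mulKVmx// trmx_annproj mulmxDl mul1mx.
by rewrite mulmxDr mulmx1 mulmxA -addrA; congr (_ + _); rewrite addrC.
Qed.

Lemma exp_transverse Z : 1%:M + Z *m gam \in unitmx -> N *m Z *m N^T = 0 ->
  \rank (Pi + gauge Z gam)%R = \rank Pi /\ direct_sum (Pi + gauge Z gam) G.
Proof.
move=> uZ NZN; set W := Pi + gauge Z gam.
pose X := gam *m Z *m N^T.
have XX : X *m X = 0.
  by rewrite /X -!mulmxA (mulmxA N^T) NTgam mul0mx !mulmx0.
have u1X : 1%:M - X \in unitmx.
  apply: (mulmx1_unit (B := 1%:M + X) _).1.
  by rewrite mulmxDl mul1mx mulmxDr mulmx1 mulNmx XX oppr0 addr0 addrK.
(* Goodness enters here: as [Pi *m gam = N - 1%:M], the product [Pi *m X] reduces to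
   [- (Z *m N^T)]. *)
have PiX : (1%:M + Z *m gam) *m W = Pi *m (1%:M - X).
  rewrite expE// mulmxDr mulmx1 mulmxN /X !mulmxA; congr (_ + _).
  have -> : Pi *m gam = N - 1%:M by rewrite addrC addKr.
  by rewrite mulmxBl mulmxBl NZN mul1mx sub0r opprK.
have WE : (W :=: Pi *m (1%:M - X))%MS.
  by rewrite -PiX; apply: eqmx_sym; apply: eqmxMfull; rewrite row_full_unit.
have rW : \rank W = \rank Pi by rewrite WE mxrankMfree// row_free_unit.
split=> //; apply: direct_sumP => [|v].
  by rewrite rW addnC direct_sum_rank.
(* A vector of [im W] has the form [eta *m Pi *m (1%:M - X)]. If it lies in [G], applying [gam]
   removes [X] and leaves [eta *m Pi *m gam = 0], whence [eta *m Pi = 0]. *)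
rewrite WE => /submxP[eta ->] /Ggam.
rewrite mulmxA mulmxDr mulmx1 mulmxN mulmxDl mulNmx.
have Xgam : X *m gam = 0 by rewrite /X -mulmxA NTgam mulmx0.
rewrite -(mulmxA _ X) Xgam mulmx0 subr0 => /(congr1 (mulmx^~ Pi)).
rewrite -!mulmxA (mulmxA Pi) PigamPi mul0mx mulmxN => /eqP.
by rewrite oppr_eq0 => /eqP e; rewrite !mulmxA !e !mul0mx ?subrr.
Qed.

(** A covector [eta] in the kernel satisfies [eta *m N = eta *m W *m gam]. As [N] is idempotent and
    [gam *m N = 0], both sides vanish. Hence [eta *m W] lies in [im W] and in [G], so it is zero. *)
Lemma transverse_unitmx W : skew_mx W -> direct_sum W G ->
  1%:M + (W - Pi) *m - gam \in unitmx.
Proof.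
rewrite /skew_mx => sW WG; rewrite -row_free_unit; apply/inj_row_free => eta.
rewrite mulmxN mulmxDl mulNmx opprD opprK addrCA -/N addrC mulmxDr mulmxN.
move=> /eqP; rewrite subr_eq0 => /eqP NW.
have NN : N *m N = N by rewrite {1}/N mulmxDl mul1mx -mulmxA gamN mulmx0 addr0.
have etaN : eta *m N = 0.
  by rewrite -NN mulmxA NW -!mulmxA gamN !mulmx0.
have etaW : eta *m W = 0.
  have WG0 := WG.2; apply/eqP; rewrite -submx0 -WG0 sub_capmx submxMl/=.
  by apply: gam_eq0; rewrite -mulmxA -NW.
have etaE : eta = - (eta *m Pi *m gam).
  by apply/eqP; rewrite -addr_eq0 -{1}(mulmx1 eta) -mulmxA -mulmxDr etaN.
(* [eta] annihilates [im W] because [W] is skew and [eta *m W = 0]; it annihilates [G] because it is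
   a value of [gam]. Together these two subspaces span everything. *)
apply: trmx_inj; rewrite trmx0; apply/row_matrixP => i.
rewrite row0 -(mul1mx eta^T) row_mul.
have [w [g [/submxP[c ->] gG ->]]] := direct_sum_decomp (row i 1%:M) WG.
rewrite mulmxDl -mulmxA -[W]opprK -sW mulNmx -trmx_mul etaW trmx0 oppr0 mulmx0.
rewrite add0r etaE linearN /= !trmx_mul sgam mulNmx opprK mulmxA.
by rewrite Ggam// mul0mx.
Qed.

Lemma transverse_good Z : 1%:M + Z *m gam \in unitmx ->
  direct_sum (Pi + gauge Z gam) G -> N *m Z *m N^T = 0.
Proof.
move=> uZ [_ WG0]; have Y := expE uZ.
have NY : N *m (Pi + Z *m N^T) = N *m Z *m N^T.
  by rewrite mulmxDr NPi add0r mulmxA.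
apply/eqP; rewrite -submx0 -WG0 sub_capmx; apply/andP; split.
  by rewrite -NY -Y mulmxA submxMl.
(* Membership in [G] is tested by [gam], which is killed by the right factor [N^T]. *)
apply/row_subP => i; apply: gam_eq0.
by rewrite -row_mul -mulmxA NTgam mulmx0 row0.
Qed.

End Splitting.

(** * Charts and extension of covectors *)

Section Charts.
Context {R : realType} {n : nat}.

Lemma smooth_on_jacobian m (U : set 'rV[R]_n) (f : 'rV[R]_n -> 'rV[R]_m) :
  open U -> smooth_on U f -> smooth_on U (jacobian f).
Proof.
move=> oU sf; apply: smooth_on_mx => // i j.
apply: (@smooth_on_eq _ _ _ _ (fun u => 'D_(delta_mx 0 i) f u 0 j : R^o)) => //.
  move=> u /set_mem Uu; rewrite deriveEjacobian.
    by rewrite -rowE mxE.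
  exact: smooth_on_differentiable Uu.
by apply: smooth_on_coord => //; exact: smooth_on_derive.
Qed.

Variable M : manifold R n.
Implicit Types (c d e : chart R n M) (y : M) (A : set M).

Lemma cod_from c u : cod c u -> dom c (from c u).
Proof. by move=> [y cy <-]; rewrite to_fromK. Qed.

Lemma cod_fromK c u : cod c u -> to c (from c u) = u.
Proof. by move=> [y cy <-]; rewrite to_fromK. Qed.

Lemma cod_to c y : dom c y -> cod c (to c y).
Proof. by move=> cy; exists y. Qed.

(** [from c] is continuous only at points of [cod c], so the preimage is open after intersecting
    with [cod c]. *)
Lemma open_cod_preimage c A : open A -> open (cod c `&` from c @^-1` A).
Proof.
move=> oA; rewrite openE => u [cu Au]; apply: filterI.
  by apply: open_nbhs_nbhs; split=> //; exact: cod_open.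
by apply: (from_cont cu); apply: open_nbhs_nbhs.
Qed.

Lemma open_cod c : open (cod c). Proof. exact: cod_open. Qed.

Lemma nbhs_cod c y : dom c y -> nbhs (to c y) (cod c).
Proof.
by move=> cy; apply: open_nbhs_nbhs; split; [exact: open_cod|exists y].
Qed.

Lemma smooth_on_transition c d : atlas c -> atlas d ->
  smooth_on (cod c `&` from c @^-1` dom d) (to d \o from c).
Proof.
move=> ac ad; have [+ _] := atlas_compatible ac ad.
by apply: smooth_on_sub => _ [[y cy <-]]; rewrite /= to_fromK//; exists y.
Qed.

Lemma mulmx_Jac c d y (v : 'rV[R]_n) :
  differentiable (to d \o from c) (to c y) ->
  v *m Jac c d y = 'D_v (to d \o from c) (to c y).
Proof. by move=> dcd; rewrite deriveEjacobian. Qed.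

Lemma differentiable_transition c d y : atlas c -> atlas d ->
  dom c y -> dom d y -> differentiable (to d \o from c) (to c y).
Proof.
move=> ac ad cy dy.
apply: smooth_on_differentiable (smooth_on_transition ac ad) _.
by split; [exact: cod_to|rewrite /= to_fromK].
Qed.

Lemma Jac_id c y : dom c y -> Jac c c y = 1%:M.
Proof.
move=> cy; apply/row_matrixP => i; rewrite !rowE.
have : \forall u \near to c y, id u = (to c \o from c) u.
  have /filterS := nbhs_cod cy; apply=> u cu.
  by rewrite /= cod_fromK.
move=> e; rewrite mulmx_Jac//; last exact: near_eq_differentiable e _.
by rewrite -(near_eq_derive _ e) derive_id mulmx1.
Qed.

Lemma Jac_comp c d e y : atlas c -> atlas d -> atlas e ->
  dom c y -> dom d y -> dom e y -> Jac c d y *m Jac d e y = Jac c e y.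
Proof.
move=> ac ad ae cy dy ey; apply/row_matrixP => i; rewrite !rowE mulmxA.
have dcd := differentiable_transition ac ad cy dy.
have dde : differentiable (to e \o from d) ((to d \o from c) (to c y)).
  by rewrite /= to_fromK//; exact: differentiable_transition.
(* The two transitions need agree only where [from c] lands in [dom d], an open condition at
   [to c y]; derivatives see nothing else. *)
have near_comp : \forall u \near to c y,
    (to e \o from d \o (to d \o from c)) u = (to e \o from c) u.
  have cdy : (cod c `&` from c @^-1` dom d) (to c y).
    by split; [exact: cod_to|rewrite /= to_fromK].
  have ocd := open_cod_preimage (@dom_open _ _ _ d).
  have /filterS := open_nbhs_nbhs (conj (ocd c) cdy).
  by apply=> u [cu du]; rewrite /= to_fromK.
have dce := differentiable_transition ac ae cy ey.
(* Rewriting would try to unify two [Jac]s, unfolding ['d] down to a choice. *)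
apply: etrans (congr1 (mulmx^~ _) (mulmx_Jac _ dcd)) _.
apply: etrans (mulmx_Jac _ (differentiable_transition ad ae dy ey)) _.
apply: etrans _ (esym (mulmx_Jac _ dce)).
rewrite -(near_eq_derive _ near_comp) (derive_comp _ dcd dde).
have dcy : to d y = (to d \o from c) (to c y) by rewrite /= to_fromK.
exact: (congr1 (fun u => 'D_('D_(delta_mx 0 i) (to d \o from c) (to c y))
  (to e \o from d) u) dcy).
Qed.

Lemma Jac_inv c d y : atlas c -> atlas d -> dom c y -> dom d y ->
  Jac c d y *m Jac d c y = 1%:M.
Proof. by move=> *; rewrite Jac_comp// Jac_id. Qed.

Let chart_at_inv c y : atlas c -> dom c y ->
  Jac (chart_at y) c y *m Jac c (chart_at y) y = 1%:M.
Proof.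
by move=> *; apply: Jac_inv => //; [exact: chart_at_atlas|exact: chart_at_dom].
Qed.

Lemma bivector_inD c y Z W :
  bivector_in c y (Z + W) = bivector_in c y Z + bivector_in c y W.
Proof. by rewrite /bivector_in mulmxDr mulmxDl. Qed.

Lemma bivector_inN c y Z : bivector_in c y (- Z) = - bivector_in c y Z.
Proof. by rewrite /bivector_in mulmxN mulNmx. Qed.

Lemma form2_inN c y b : form2_in c y (- b) = - form2_in c y b.
Proof. by rewrite /form2_in mulmxN mulNmx. Qed.

Lemma unitmx_in c y Z b : atlas c -> dom c y ->
  (1%:M + bivector_in c y Z *m form2_in c y b \in unitmx) =
  (1%:M + Z *m b \in unitmx).
Proof. by move=> ac cy; apply: unitmx_gauge_conj; exact: chart_at_inv. Qed.

Lemma bivector_in_gauge c y Z b : atlas c -> dom c y ->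
  1%:M + Z *m b \in unitmx ->
  bivector_in c y (gauge Z b) = gauge (bivector_in c y Z) (form2_in c y b).
Proof. by move=> ac cy uZ; rewrite gauge_conj//; exact: chart_at_inv. Qed.

(** Adjacent Jacobians cancel in pairs. This expresses the projection of a 1-form by
    [1%:M + Pi *m gamma] in any chart. *)
Lemma covector_inM c y eta Z b : atlas c -> dom c y ->
  covector_in c y (eta *m Z *m b) =
  covector_in c y eta *m bivector_in c y Z *m form2_in c y b.
Proof.
move=> ac cy; move: (chart_at_inv ac cy).
rewrite /covector_in /bivector_in /form2_in.
move: (Jac _ c y) (Jac c _ y) => J J' JJ'; rewrite !mulmxA; congr (_ *m _).
rewrite -[eta *m J'^T *m _]mulmxA -trmx_mul JJ' trmx1 mulmx1.
by rewrite -[eta *m Z *m J *m _]mulmxA JJ' mulmx1.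
Qed.

End Charts.

Arguments open_cod {R n M} c.

(** * Bump functions and global 1-forms with a prescribed value *)

Section Extension.
Context {R : realType} {n : nat}.

(** The Euclidean square is polynomial in the coordinates, whereas the norm on ['rV[R]_n] is a
    maximum and not smooth in general. *)
Definition sqdist (u v : 'rV[R]_n) : R := \sum_i (u 0 i - v 0 i) ^+ 2.

Definition bump (r : R) (u0 u : 'rV[R]_n) : R := flat 1 (r ^+ 2 - sqdist u u0).

Lemma bump_center r u0 : 0 < r -> bump r u0 u0 != 0.
Proof.
move=> r0; rewrite /bump /sqdist big1 => [|i _]; last by rewrite subrr expr0n.
by rewrite subr0 /flat exprn_gt0// hornerC mul1r gt_eqF// expR_gt0.
Qed.

Lemma bump_eq0 r u0 u : 0 < r -> bump r u0 u != 0 -> `|u - u0| <= r.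
Proof.
move=> r0; rewrite /bump /flat; case: ifPn => [|_]; last by rewrite eqxx.
rewrite subr_gt0 => ur _; rewrite /Num.norm/= mx_normrE.
rewrite (bigmax_le _ (ltW r0))// => -[i j] _.
rewrite !mxE /= ord1 -(ler_pXn2r (n := 2)) ?nnegrE ?(ltW r0)//.
rewrite real_normK ?num_real// (le_trans _ (ltW ur))//.
rewrite /sqdist (bigD1 j)//= lerDl; apply: sumr_ge0 => k _; exact: sqr_ge0.
Qed.

Lemma smooth_bump (V : normedModType R) (U : set V) (f : V -> 'rV[R]_n) r u0 :
  open U -> smooth_on U f -> smooth_on U (fun x => bump r u0 (f x) : R^o).
Proof.
move=> oU sf; apply: smooth_flat => //; apply: smooth_onB => //.
  exact: smooth_on_cst.
apply: smooth_on_sum => // i.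
have s : smooth_on U (fun x => f x 0 i - u0 0 i : R^o).
  by apply: smooth_onB => //; [exact: smooth_on_coord|exact: smooth_on_cst].
exact: smooth_onM.
Qed.

Lemma compact_closed_ball (u : 'rV[R]_n) r : 0 < r -> compact (closed_ball u r).
Proof.
move=> r0; apply: bounded_closed_compact; last exact: closed_ball_closed.
rewrite closed_ballE//; exists (r + `|u|); split; first exact: num_real.
move=> t rt v; rewrite /closed_ball_/= distrC => vu; rewrite -(subrK u v).
by rewrite (le_trans (ler_normD _ _))// (le_trans _ (ltW rt))// lerD2r.
Qed.

Variable M : manifold R n.

(** The form with constant components [eta] in a chart at [x] is cut off by a bump function and
    extended by zero. Smoothness is local: a point is either in [dom c] or outside the compact set
    [K] that contains the support. *)
Lemma form1_extension (x : M) (eta : 'rV[R]_n) :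
  exists2 a : M -> 'rV[R]_n, form1_field a & a x = eta.
Proof.
pose c := chart_at x; have ac : atlas c := chart_at_atlas x.
have cx : dom c x := chart_at_dom x; pose u0 := to c x.
have [r r0 rc] : exists2 r : R, 0 < r & closed_ball u0 r `<=` cod c.
  have /nbhs_closedballP[r rc] := nbhs_cod cx.
  by exists r%:num.
(* [K] is compact, hence closed since the manifold is Hausdorff; this makes its complement an open
   set on which the form vanishes. *)
pose K := from c @` closed_ball u0 r.
have closedK : closed K.
  apply: compact_closed; first exact: manifold_hausdorff.
  apply: continuous_compact; last exact: compact_closed_ball.
  by apply: continuous_in_subspaceT => u /set_mem /rc; exact: from_cont.
pose phi u := bump r u0 u / bump r u0 u0.
(* The transposed Jacobian inverts [covector_in c y], so that the components of [a] in [c] are [phi]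
   times [eta]. *)
pose a y := if `[< dom c y >] then
  phi (to c y) *: (eta *m (Jac (chart_at y) c y)^T) else 0.
exists a; last first.
  by rewrite /a asboolT// /phi mulfV ?bump_center// scale1r Jac_id// trmx1 mulmx1.
move=> d ad; apply: smooth_on_local => u du; set y := from d u.
have dy : dom d y by exact: cod_from.
have [cy|Ncy] := pselect (dom c y).
  pose U := cod d `&` from d @^-1` dom c.
  have oU : open U by apply: open_cod_preimage; exact: dom_open.
  exists U => //.
  apply: (@smooth_on_eq _ _ _ _ (fun u => phi ((to c \o from d) u) *:
      (eta *m (jacobian (to c \o from d) u)^T))) => // [v /set_mem[dv cv]|].
    have dv' := cod_from dv.
    rewrite /a asboolT// /covector_in -scalemxAl -mulmxA -trmx_mul.
    congr (_ *: (_ *m _^T)).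
    apply/esym/(etrans (Jac_comp ad (chart_at_atlas _) ac dv' (chart_at_dom _) cv)).
    by rewrite /Jac cod_fromK.
  have sdc := smooth_on_transition ad ac.
  apply: smooth_on_mx => // i j.
  apply: smooth_on_ext => [v|]; first exact: mxE.
  apply: smooth_onM => //.
    by apply: smooth_onM => //; [exact: smooth_bump|exact: smooth_on_cst].
  apply: smooth_on_coord => //; apply: smooth_on_mulmx => //.
    exact: smooth_on_cst.
  by apply: smooth_on_trmx => //; exact: smooth_on_jacobian.
have NKy : ~ K y.
  by move=> [v /rc cv vy]; apply: Ncy; rewrite -vy; exact: cod_from.
pose U := cod d `&` from d @^-1` ~` K.
have oU : open U by apply: open_cod_preimage; exact: closed_openC.
exists U => //; apply: (@smooth_on_eq _ _ _ _ (fun=> 0)) => //; last first.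
  exact: smooth_on_cst.
(* Off [K] the form vanishes by the default value outside [dom c], and by [bump_eq0] inside it. *)
move=> v /set_mem[dv NKv]; rewrite /a; case: asboolP => [cv|_]; last first.
  by rewrite /covector_in mul0mx.
rewrite (_ : phi _ = 0) ?scale0r ?/covector_in ?mul0mx//.
apply/eqP; apply: contrapT => /negP phi0; apply: NKv.
exists (to c (from d v)); last exact: to_fromK.
rewrite closed_ballE// /closed_ball_/= distrC.
apply: bump_eq0 => //; apply: contraNN phi0 => /eqP.
by rewrite /phi => ->; rewrite mul0r.
Qed.

End Extension.

(** * The exponential on bivectors and on sections *)

Section Shear.
Context {R : realType} {n : nat} (M : manifold R n).
Implicit Types (P Q Z W b : M -> 'M[R]_n) (z : M * 'M[R]_n).

(* [P := 0], [Q := Pi], [b := gamma] gives [exp_G], and [P := Pi], [Q := 0],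
   [b := - gamma] gives its inverse. *)
Definition I_shift P b : set (M * 'M[R]_n) :=
  [set z | skew_mx z.2 /\ 1%:M + (z.2 - P z.1) *m b z.1 \in unitmx].

Definition shear P Q b z : M * 'M[R]_n :=
  (z.1, Q z.1 + gauge (z.2 - P z.1) (b z.1)).

Lemma skew_mxD (A B : 'M[R]_n) : skew_mx A -> skew_mx B -> skew_mx (A + B).
Proof. by rewrite /skew_mx linearD /= opprD => -> ->. Qed.

Lemma skew_mxN (A : 'M[R]_n) : skew_mx A -> skew_mx (- A).
Proof. by rewrite /skew_mx linearN /= => ->. Qed.

Lemma skew_mx0 : skew_mx (0 : 'M[R]_n).
Proof. by rewrite /skew_mx trmx0 oppr0. Qed.

Lemma bivector_field0 : bivector_field (fun _ : M => 0 : 'M[R]_n).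
Proof.
split=> [x|c ac]; first exact: skew_mx0.
apply: (@smooth_on_ext _ _ _ _ (fun=> 0)) => [u|]; last exact: smooth_on_cst.
by rewrite /bivector_in mulmx0 mul0mx.
Qed.

Lemma form2_fieldN b : form2_field b -> form2_field (- b).
Proof.
move=> [sb smb]; split=> [x|c ac]; first exact: skew_mxN.
apply: smooth_on_ext => [u|]; first exact: form2_inN.
by apply: smooth_onN; [exact: open_cod|exact: smb].
Qed.

Lemma smooth_on_gauge (V : normedModType R) (U : set V) (A B : V -> 'M[R]_n) :
  open U -> (forall v, U v -> 1%:M + A v *m B v \in unitmx) ->
  smooth_on U A -> smooth_on U B -> smooth_on U (fun v => gauge (A v) (B v)).
Proof.
move=> oU u sA sB; apply: smooth_on_mulmx => //; apply: smooth_on_invmx => //.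
by apply: smooth_onD => //; [exact: smooth_on_cst|exact: smooth_on_mulmx].
Qed.

Lemma open_smooth_neq0 (V : normedModType R) (U : set V) (h : V -> R^o) :
  open U -> smooth_on U h -> open (U `&` [set v | h v != 0]).
Proof.
move=> oU sh; rewrite openE => v [Uv hv]; apply: filterI.
  exact: open_nbhs_nbhs.
have ch : h v' @[v' --> v] --> h v := smooth_on_continuous sh Uv.
by apply: (ch [set t | t != 0]); apply: open_nbhs_nbhs; split.
Qed.

(** This is the invertibility condition of [I_shift] read in [c] on all matrices, skew or not, so
    that it cuts out an open set of the ambient space. *)
Definition local_domain P b (c : chart R n M) : set ('rV[R]_n * 'M[R]_n) :=
  [set w | cod c w.1] `&` [set w | \det (1%:M +
    (w.2 - bivector_in c (from c w.1) (P (from c w.1))) *m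
    form2_in c (from c w.1) (b (from c w.1))) != 0].

Variables P Q b : M -> 'M[R]_n.
Hypotheses (fP : bivector_field P) (fQ : bivector_field Q) (fb : form2_field b).

Let open_cylinder (c : chart R n M) :
  open [set w : 'rV[R]_n * 'M[R]_n | cod c w.1].
Proof. apply: (@open_comp _ _ (fst : 'rV[R]_n * 'M[R]_n -> 'rV[R]_n) (cod c)).
  by move=> w _; exact: cvg_fst.
exact: open_cod.
 Qed.

Let smooth_shift (c : chart R n M) : atlas c -> smooth_on [set w | cod c w.1]
  (fun w => w.2 - bivector_in c (from c w.1) (P (from c w.1))).
Proof.
move=> ac; apply: smooth_onB; [exact: open_cylinder| |].
  exact/smooth_on_snd/open_cylinder.
exact: (smooth_on_fst (open_cod c) (fP.2 c ac)).
Qed.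

Let smooth_form (c : chart R n M) : atlas c ->
  smooth_on [set w : 'rV[R]_n * 'M[R]_n | cod c w.1]
    (fun w => form2_in c (from c w.1) (b (from c w.1))).
Proof. by move=> ac; exact: (smooth_on_fst (open_cod c) (fb.2 c ac)). Qed.

Lemma open_local_domain (c : chart R n M) : atlas c -> open (local_domain P b c).
Proof.
move=> ac; apply: open_smooth_neq0; first exact: open_cylinder.
apply: smooth_on_det => [|i j]; first exact: open_cylinder.
apply: smooth_on_coord; first exact: open_cylinder.
apply: smooth_onD; [exact: open_cylinder|exact: smooth_on_cst|].
apply: smooth_on_mulmx; first exact: open_cylinder.
  exact: smooth_shift.
exact: smooth_form.
Qed.

Lemma local_domain_bcoord (c : chart R n M) z : atlas c -> dom c z.1 ->
  local_domain P b c (bcoord c z) <->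
  1%:M + (z.2 - P z.1) *m b z.1 \in unitmx.
Proof.
move=> ac cz; rewrite /local_domain /bcoord /= to_fromK//.
rewrite -bivector_inN -bivector_inD -unitfE -unitmxE unitmx_in//.
by split=> [[]//|]; split=> //; exact: cod_to.
Qed.

Lemma open_I_shift : open_in_bivectors (I_shift P b).
Proof.
split=> [z []//|z [sz uz] c ac cz]; exists (local_domain P b c); split.
- exact: open_local_domain.
- exact/local_domain_bcoord.
- by move=> z' sz' cz' /(local_domain_bcoord ac cz').
Qed.

(** The base point is fixed, so one chart serves for source and target; by naturality of [gauge],
    the same formula in components gives the ambient smooth map. *)
Lemma smooth_shear : smooth_bivector_map (I_shift P b) (shear P Q b).
Proof.
move=> z [sz uz]; have ac := chart_at_atlas z.1; have cz := chart_at_dom z.1.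
set c := chart_at z.1 in ac cz; exists c, c; split=> //.
exists (local_domain P b c), (fun w =>
  (w.1, bivector_in c (from c w.1) (Q (from c w.1)) +
     gauge (w.2 - bivector_in c (from c w.1) (P (from c w.1)))
       (form2_in c (from c w.1) (b (from c w.1))))).
have oO := open_local_domain ac.
have sub : local_domain P b c `<=` [set w | cod c w.1] by move=> w [].
split=> //; first exact/local_domain_bcoord.
  apply: smooth_on_pair => //.
    apply: smooth_on_sub sub _.
    exact: (smooth_on_fst (open_cod c) (@smooth_on_id _ _ _)).
  apply: smooth_onD => //.
    apply: smooth_on_sub sub _.
    exact: (smooth_on_fst (open_cod c) (fQ.2 c ac)).
  apply: smooth_on_gauge => //.
  - by move=> w [_]; rewrite /= unitmxE unitfE.
  - exact: smooth_on_sub sub (smooth_shift ac).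
  - exact: smooth_on_sub sub (smooth_form ac).
move=> z' [sz' uz'] cz' _; split=> //.
rewrite /bcoord /shear /= to_fromK// bivector_inD bivector_in_gauge//.
by rewrite bivector_inD bivector_inN.
Qed.

Lemma bivector_field_shear W : bivector_field W ->
  (forall x, 1%:M + (W x - P x) *m b x \in unitmx) ->
  bivector_field (fun x => (shear P Q b (x, W x)).2).
Proof.
move=> fW uW; split=> [x|c ac].
  apply: skew_mxD; first exact: fQ.1.
  apply: skew_gauge; [|exact: fb.1|exact: uW].
  by apply: skew_mxD; [exact: fW.1|apply: skew_mxN; exact: fP.1].
have oc := open_cod c; pose comp (Z : M -> 'M[R]_n) u :=
  bivector_in c (from c u) (Z (from c u)).
pose bc u := form2_in c (from c u) (b (from c u)).
have unit_comp u : cod c u -> 1%:M + (comp W u - comp P u) *m bc u \in unitmx.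
  move=> cu; rewrite /comp -bivector_inN -bivector_inD unitmx_in//.
  exact: cod_from.
apply: (@smooth_on_eq _ _ _ _
    (fun u => comp Q u + gauge (comp W u - comp P u) (bc u))) => //.
  move=> u /set_mem cu; rewrite bivector_inD bivector_in_gauge//.
  - by rewrite bivector_inD bivector_inN.
  - exact: cod_from.
  - exact: uW.
apply: smooth_onD => //; first exact: (fQ.2 c ac).
apply: smooth_on_gauge => //; last exact: (fb.2 c ac).
by apply: smooth_onB => //; [exact: (fW.2 c ac)|exact: (fP.2 c ac)].
Qed.

End Shear.

(** * The fibre-preserving diffeomorphism *)

Section ExpG.
Context {R : realType} {n : nat} (M : manifold R n).
Implicit Types (Pi gamma Z : M -> 'M[R]_n).

Lemma I_betaE gamma : I_beta gamma = I_shift (fun=> 0) gamma.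
Proof. by apply/seteqP; split=> z []; rewrite /I_shift /= ?subr0. Qed.

Lemma translate_I_beta Pi gamma : (forall x, skew_mx (Pi x)) ->
  translate Pi (I_beta gamma) = I_shift Pi gamma.
Proof.
move=> sPi; apply/seteqP; split=> [_ [z [sz uz] <-]|[x W] [/= sW uW]].
  by split=> /=; [exact: skew_mxD|rewrite addrAC subrr add0r].
exists (x, W - Pi x); last by rewrite /= addrC subrK.
by split=> //=; apply: skew_mxD => //; exact: skew_mxN.
Qed.

Lemma exp_GE Pi gamma : exp_G Pi gamma = shear (fun=> 0) Pi gamma.
Proof. by apply/funext => z; rewrite /shear subr0. Qed.

Lemma exp_GK Pi gamma z : I_beta gamma z ->
  shear Pi (fun=> 0) (- gamma) (exp_G Pi gamma z) = z.
Proof.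
case: z => x Z [/= sZ uZ].
by rewrite /shear /= [Pi x + _]addrC addrK add0r gaugeK.
Qed.

Lemma exp_G_unshear Pi gamma z : I_shift Pi (- gamma) z ->
  exp_G Pi gamma (shear Pi (fun=> 0) (- gamma) z) = z.
Proof.
case: z => x W [/= sW uW]; rewrite /exp_G /shear /= add0r.
by have := gaugeK uW; rewrite opprK => ->; rewrite addrC subrK.
Qed.

Variables Pi gamma : M -> 'M[R]_n.
Hypotheses (fPi : bivector_field Pi) (fg : form2_field gamma).

Lemma exp_G_in z : I_beta gamma z -> I_shift Pi (- gamma) (exp_G Pi gamma z).
Proof.
case: z => x Z [/= sZ uZ]; split=> /=.
  by apply: skew_mxD; [exact: fPi.1|apply: skew_gauge => //; exact: fg.1].
by rewrite [Pi x + _]addrC addrK; exact: unitmx_gauge.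
Qed.

Lemma unshear_in z : I_shift Pi (- gamma) z ->
  I_beta gamma (shear Pi (fun=> 0) (- gamma) z).
Proof.
case: z => x W [/= sW uW]; split=> /=; rewrite add0r.
  apply: skew_gauge => //; last by apply: skew_mxN; exact: fg.1.
  by apply: skew_mxD => //; apply: skew_mxN; exact: fPi.1.
by have := unitmx_gauge uW; rewrite opprK.
Qed.

Lemma exp_G_diffeo : fiber_preserving_diffeo (I_beta gamma)
  (translate Pi (I_beta (- gamma))) (exp_G Pi gamma).
Proof.
have f0 := bivector_field0 M; have fNg := form2_fieldN fg.
rewrite translate_I_beta; last exact: fPi.1.
split=> //.
- by rewrite I_betaE; exact: open_I_shift.
- exact: open_I_shift.
- split.
  + exact: exp_G_in.
  + by move=> z w /set_mem Az /set_mem Aw e; rewrite -(exp_GK Pi Az) e exp_GK.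
  + by move=> z Bz; exists (shear Pi (fun=> 0) (- gamma) z);
      [exact: unshear_in|exact: exp_G_unshear].
- split; first by rewrite exp_GE I_betaE; exact: smooth_shear.
  exists (shear Pi (fun=> 0) (- gamma)); first exact: exp_GK.
  exact: smooth_shear.
Qed.

End ExpG.

(** * The bijection between good and transverse bivector fields *)

Section Sections.
Context {R : realType} {n : nat} (M : manifold R n).
Variables TF omega Pi G gamma : M -> 'M[R]_n.
Hypotheses (hPi : poisson_of TF omega Pi)
  (hGF : forall x, direct_sum (G x) (TF x))
  (hgamma : extension_by TF omega G gamma).

Lemma inverse_along_extension x : inverse_along (Pi x) (G x) (gamma x).
Proof.
have [fPi PiT kerPi PiO] := hPi; have [fg gT gG] := hgamma.
split; [|exact: fPi.1|exact: fg.1| |exact: gG].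
  have [GT GT0] := hGF x; split.
    exact: eqmx_trans (adds_eqmx (eqmx_refl _) (PiT x)) GT.
  by apply/eqP; rewrite -submx0 -GT0 capmxS//= PiT.
(* By [kerPi] it suffices that the rows of [1%:M + Pi x *m gamma x] annihilate [TF x]. Since [Pi x]
   takes values in [TF x], [gamma] may be replaced there by [omega], which inverts [- Pi]. *)
apply/row_matrixP => i; rewrite row0 row_mul; apply/kerPi => v vT.
have PiTi : (row i (Pi x) <= TF x)%MS by rewrite -(PiT x) row_sub.
rewrite linearD /= mulmxDl row_mul (gT x _ PiTi).2//.
by rewrite [row i (Pi x)]rowE PiO// row1 subrr.
Qed.

Lemma good_bivectorsP Z : bivector_field Z ->
  good_bivectors TF Z <-> forall x,
    (1%:M + Pi x *m gamma x) *m Z x *m (1%:M + Pi x *m gamma x)^T = 0.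
Proof.
have [fPi PiT kerPi PiO] := hPi; have [fg _ _] := hgamma.
move=> fZ; split=> [[_ gZ] x|NZN]; last first.
  split=> // a b _ _ aT bT x.
  (* A covector annihilating [TF x] lies in the kernel of [Pi x], so the projection fixes it. *)
  have N_id eta : annihilates eta (TF x) ->
      eta = eta *m (1%:M + Pi x *m gamma x).
    by move=> /kerPi eP; rewrite mulmxDr mulmx1 mulmxA eP mul0mx addr0.
  rewrite (N_id _ (aT x)) (N_id _ (bT x)) trmx_mul !mulmxA.
  by rewrite -!(mulmxA (a x)) NZN mul0mx mulmx0.
pose N y := 1%:M + Pi y *m gamma y.
have form1_N (a : M -> 'rV[R]_n) : form1_field a ->
    form1_field (fun y => a y *m N y).
  move=> fa c ac; have oc := open_cod c.
  pose ca u := covector_in c (from c u) (a (from c u)).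
  apply: (@smooth_on_eq _ _ _ _ (fun u => ca u + ca u *m
      bivector_in c (from c u) (Pi (from c u)) *m
      form2_in c (from c u) (gamma (from c u)))) => //.
    move=> u /set_mem /cod_from cu; rewrite /N mulmxDr mulmx1 mulmxA.
    by rewrite /ca -covector_inM// /covector_in mulmxDl.
  apply: smooth_onD => //; first exact: (fa c ac).
  apply: smooth_on_mulmx => //; last exact: (fg.2 c ac).
  by apply: smooth_on_mulmx => //; [exact: (fa c ac)|exact: (fPi.2 c ac)].
have annN (a : M -> 'rV[R]_n) y : annihilates (a y *m N y) (TF y).
  apply/kerPi; exact: annihilates_annproj (inverse_along_extension y) _.
apply/matrixP => i j; rewrite [RHS]mxE.
(* Goodness speaks of global forms. Extending two basis covectors and projecting the extensions lets
   it be evaluated at [x], where it yields the entry at [i], [j]. *)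
have [a fa ax] := form1_extension x (delta_mx 0 i).
have [c fc cx] := form1_extension x (delta_mx 0 j).
have := gZ _ _ (form1_N a fa) (form1_N c fc) (annN a) (annN c) x.
rewrite ax cx trmx_mul !mulmxA -!(mulmxA (delta_mx 0 i)) trmx_delta.
rewrite -colE -rowE => /(congr1 (fun A : 'M[R]_1 => A 0 0)).
by rewrite mxE [in RHS]mxE mxE.
Qed.

Lemma exp_G_sections : set_bij (sections (I_beta gamma) `&` good_bivectors TF)
  ([set W | bivector_field W /\ forall x, \rank (W x) = \rank (TF x)] `&`
   transverse_to G)
  (fun Z x => (exp_G Pi gamma (x, Z x)).2).
Proof.
have [fPi PiT _ _] := hPi; have [fg _ _] := hgamma.
have PG := inverse_along_extension; split.
- move=> Z [[fZ IZ] /good_bivectorsP-/(_ fZ) NZN].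
  have uZ x : 1%:M + Z x *m gamma x \in unitmx by case: (IZ x).
  have expZ x := exp_transverse (PG x) (uZ x) (NZN x).
  split; last by move=> x; case: (expZ x).
  split=> [|x]; last by rewrite (expZ x).1 (PiT x).
  rewrite exp_GE; apply: bivector_field_shear => //; first exact: bivector_field0.
  by move=> x; rewrite subr0.
- move=> Z Z' /set_mem [[_ IZ] _] /set_mem [[_ IZ'] _] e; apply/funext => x.
  have := exp_GK Pi (IZ x); have := congr1 (@^~ x) e => /= ex.
  have -> : exp_G Pi gamma (x, Z x) = exp_G Pi gamma (x, Z' x).
    by rewrite /exp_G /= ex.
  by rewrite (exp_GK Pi (IZ' x)) => -[].
(* The preimage is forced to be the fibrewise inverse. [transverse_unitmx] puts [W] in its domain,
   and [transverse_good], applied to [exp_G] of the result, shows that the preimage is good. *)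
- move=> W [[fW _] WG]; pose Z x := (shear Pi (fun=> 0) (- gamma) (x, W x)).2.
  have IW x : I_shift Pi (- gamma) (x, W x).
    split; first exact: fW.1.
    by apply: (transverse_unitmx (PG x)); [exact: fW.1|exact: WG].
  have IZ x : I_beta gamma (x, Z x) by exact: (unshear_in fPi fg (IW x)).
  have expZ x : exp_G Pi gamma (x, Z x) = (x, W x).
    exact: (exp_G_unshear (IW x)).
  have fZ : bivector_field Z.
    apply: bivector_field_shear => //.
    + exact: bivector_field0.
    + exact: form2_fieldN.
    + by move=> x; case: (IW x).
  exists Z; last by apply/funext => x; rewrite expZ.
  split; first by split.
  apply/(good_bivectorsP fZ) => x; apply: (transverse_good (PG x)).
    by case: (IZ x).
  by have [WE] := expZ x; rewrite WE; exact: WG.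
Qed.

End Sections.

Theorem theorem2p6 (R : realType) (n k : nat) (M : manifold R n)
    (TF omega Pi G gamma : M -> 'M[R]_n)
    (hF : symplectic_foliation k.*2 TF omega)
    (hPi : poisson_of TF omega Pi)
    (hG : smooth_distribution G)
    (hGF : forall x, direct_sum (G x) (TF x))
    (hgamma : extension_by TF omega G gamma) :
  fiber_preserving_diffeo (I_beta gamma) (translate Pi (I_beta (- gamma)))
    (exp_G Pi gamma) /\
  set_bij (sections (I_beta gamma) `&` good_bivectors TF)
    (regular_bivectors k.*2 `&` transverse_to G)
    (fun (Z : M -> 'M[R]_n) (x : M) => (exp_G Pi gamma (x, Z x)).2).
Proof.
have [[rT _] _ _ _] := hF; have [fPi _ _ _] := hPi; have [fg _ _] := hgamma.
split; first exact: exp_G_diffeo.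
have := exp_G_sections hPi hGF hgamma.
(* Only the rank condition remains to be matched: the leaves have constant dimension [k.*2]. *)
congr set_bij; congr (_ `&` _).
by apply/seteqP; split=> W [fW rW]; split=> // x; rewrite rW rT.
Qed.
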